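(* Let $\ell\in\frac12\mathbb{N}$, $\nu>0$, and let $P^{(\nu)}_n$ be the monic matrix-valued Gegenbauer polynomials defined in the context. They satisfy, for all $n\ge0$ (with $P^{(\nu)}_{-1}=0$, so that the last term is absent for $n=0$), the three-term recurrence relation $$xP^{(\nu)}_n(x)=P^{(\nu)}_{n+1}(x)+B^{(\nu)}_nP^{(\nu)}_n(x)+C^{(\nu)}_nP^{(\nu)}_{n-1}(x),$$ where $$B^{(\nu)}_n=\sum_{j=1}^{2\ell}\frac{j(j+\nu-1)}{2(j+n+\nu-1)(j+n+\nu)}E_{j,j-1}+\sum_{j=0}^{2\ell-1}\frac{(2\ell-j)(2\ell-j+\nu-1)}{2(2\ell-j+n+\nu-1)(2\ell+n-j+\nu)}E_{j,j+1},$$ $$C^{(\nu)}_n=\sum_{j=0}^{2\ell}\frac{n(n+\nu-1)(2\ell+n+\nu)(2\ell+n+2\nu-1)}{4(2\ell+n+\nu-j-1)(2\ell+n+\nu-j)(j+n+\nu-1)(j+n+\nu)}E_{j,j}.$$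
   Context: Matrices are $(2\ell+1)\times(2\ell+1)$, indexed by $\{0,1,\dots,2\ell\}$; $E_{i,j}$ are the matrix units; $\mathbb{N}=\{0,1,2,\dots\}$; $(a)_0=1$, $(a)_n=a(a+1)\cdots(a+n-1)$. The scalar Gegenbauer polynomials are denoted with an argument, $C^{(\nu)}_n(x)=\frac{(2\nu)_n}{n!}\,{}_2F_1\!\left(-n,\,n+2\nu;\,\nu+\tfrac12;\,\tfrac12(1-x)\right)$ (not to be confused with the matrix $C^{(\nu)}_n$ of the claim). Definition of the weight. For $x\in(-1,1)$ and $m,n\in\{0,\dots,2\ell\}$ with $n\ge m$, $$\bigl(W^{(\nu)}(x)\bigr)_{m,n}=(1-x^2)^{\nu-1/2}\sum_{t=\max(0,n+m-2\ell)}^{m}\alpha^{(\nu)}_t(m,n)\,C^{(\nu)}_{m+n-2t}(x),$$ $$\alpha^{(\nu)}_t(m,n)=(-1)^m\frac{n!\,m!\,(m+n-2t)!}{t!\,(2\nu)_{m+n-2t}\,(\nu)_{n+m-t}}\,\frac{(\nu)_{n-t}(\nu)_{m-t}}{(n-t)!\,(m-t)!}\,\frac{n+m-2t+\nu}{n+m-t+\nu}\,(2\ell-m)!\,(n-2\ell)_{m-t}\,(-2\ell-\nu)_t\,\frac{2\ell+\nu}{(2\ell)!},$$ and $W^{(\nu)}(x)$ is extended to a symmetric matrix; it is positive definite for $x\in(-1,1)$. $P^{(\nu)}_n(x)=x^n\,\mathrm{I}+x^{n-1}P^{(\nu)}_{n,n-1}+\cdots+P^{(\nu)}_{n,0}$,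 with $P^{(\nu)}_{n,i}\in M_{2\ell+1}(\mathbb{C})$, are the unique monic matrix-valued polynomials satisfying $\int_{-1}^1P^{(\nu)}_n(x)W^{(\nu)}(x)\bigl(P^{(\nu)}_m(x)\bigr)^\ast dx=\delta_{n,m}H^{(\nu)}_n$ with $H^{(\nu)}_n$ positive definite. *)

(* Defs.v *)
From HB Require Import structures.
From mathcomp Require Import all_boot all_order all_algebra.
From mathcomp Require Import all_classical all_reals all_analysis.
From mathcomp Require Import complex.

Set Implicit Arguments.
Unset Strict Implicit.
Unset Printing Implicit Defensive.

Import Order.TTheory GRing.Theory Num.Theory.
Import numFieldNormedType.Exports.

Local Open Scope classical_set_scope.
Local Open Scope ring_scope.
Local Open Scope sesquilinear_scope.
Local Open Scope complex_scope.

(* Throughout, L : nat stands for 2 * ell with ell a half-integer >= 0, so that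
   matrices are L.+1 x L.+1 and indexed by {0, ..., L}.  P : {poly 'M_L.+1} is a
   matrix-valued polynomial with coefficients written on the left. *)

Section ScalarFunctions.
Variable R : realType.
Implicit Types (a b c z nu x : R).

Definition pochhammer a (n : nat) : R := \prod_(i < n) (a + i%:R).

Definition hypergeometric2F1 a b c z : R :=
  limn (series (fun k : nat =>
    pochhammer a k * pochhammer b k / (pochhammer c k * k`!%:R) * z ^+ k)).

Definition gegenbauer nu (n : nat) x : R :=
  pochhammer (2 * nu) n / n`!%:R *
  hypergeometric2F1 (- n%:R) (n%:R + 2 * nu) (nu + 1 / 2) (1 / 2 * (1 - x)).

End ScalarFunctions.

Section Weight.
Variables (R : realType) (L : nat) (nu : R).

Definition weight_coef (m n t : nat) : R :=
  (-1) ^+ m *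
  ((n`! * m`! * (m + n - 2 * t)`!)%:R /
     (t`!%:R * pochhammer (2 * nu) (m + n - 2 * t)
             * pochhammer nu (n + m - t))) *
  (pochhammer nu (n - t) * pochhammer nu (m - t) /
     ((n - t)`! * (m - t)`!)%:R) *
  (((n + m - 2 * t)%:R + nu) / ((n + m - t)%:R + nu)) *
  (L - m)`!%:R *
  pochhammer (n%:R - L%:R) (m - t) *
  pochhammer (- L%:R - nu) t *
  ((L%:R + nu) / L`!%:R).

(* The truncated subtraction n + m - L is max(0, n + m - 2 ell). *)
Definition weight_entry (m n : nat) (x : R) : R :=
  (1 - x ^+ 2) `^ (nu - 1 / 2) *
  \sum_((n + m - L)%N <= t < m.+1)
     weight_coef m n t * gegenbauer nu (m + n - 2 * t) x.

Definition weight (x : R) : 'M[R]_L.+1 :=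
  \matrix_(m, n) if (m <= n)%N then weight_entry m n x else weight_entry n m x.

End Weight.

Section Orthogonality.
Variables (R : realType) (L : nat).
Local Notation Mat := 'M[R[i]]_L.+1.

Definition complex_integral (D : set R) (f : R -> R[i]) : R[i] :=
  (\int[lebesgue_measure]_(x in D) complex.Re (f x)) +i*
  (\int[lebesgue_measure]_(x in D) complex.Im (f x)).

Definition mx_integral (D : set R) (F : R -> Mat) : Mat :=
  \matrix_(i, j) complex_integral D (fun x => F x i j).

Definition mxpoly_eval (P : {poly Mat}) (x : R) : Mat := P.[(x%:C)%:M].

Definition mxpoly_ip (W : R -> 'M[R]_L.+1) (P Q : {poly Mat}) : Mat :=
  mx_integral `]-1, 1[ (fun x =>
    mxpoly_eval P x *m map_mx (real_complex R) (W x) *m (mxpoly_eval Q x)^t*).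

(* In the order of R[i], 0 < z means that z is real and positive. *)
Definition posdefmx (A : Mat) : Prop :=
  A \is hermsymmx /\
  forall v : 'rV[R[i]]_L.+1, v != 0 -> 0 < (v *m A *m v^t*) 0 0.

Definition monic_mvop (W : R -> 'M[R]_L.+1) (P : nat -> {poly Mat}) : Prop :=
  (forall n, P n \is monic /\ size (P n) = n.+1) /\
  exists H : nat -> Mat,
    (forall n, posdefmx (H n)) /\
    (forall n m, mxpoly_ip W (P n) (P m) = (n == m)%:R *: H n).

End Orthogonality.

Section Recurrence.
Variables (R : realType) (L : nat) (nu : R).

Definition Emx (i j : nat) : 'M[R]_L.+1 := delta_mx (inord i) (inord j).

Definition recB (n : nat) : 'M[R[i]]_L.+1 := map_mx (real_complex R) (
  \sum_(1 <= j < L.+1)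
     (j%:R * (j%:R + nu - 1) /
       (2 * (j%:R + n%:R + nu - 1) * (j%:R + n%:R + nu))) *: Emx j j.-1 +
  \sum_(0 <= j < L)
     ((L%:R - j%:R) * (L%:R - j%:R + nu - 1) /
       (2 * (L%:R - j%:R + n%:R + nu - 1) * (L%:R + n%:R - j%:R + nu)))
       *: Emx j j.+1).

Definition recC (n : nat) : 'M[R[i]]_L.+1 := map_mx (real_complex R) (
  \sum_(0 <= j < L.+1)
     (n%:R * (n%:R + nu - 1) * (L%:R + n%:R + nu) *
        (L%:R + n%:R + 2 * nu - 1) /
       (4 * (L%:R + n%:R + nu - j%:R - 1) * (L%:R + n%:R + nu - j%:R) *
        (j%:R + n%:R + nu - 1) * (j%:R + n%:R + nu))) *: Emx j j).

End Recurrence.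

(* Main.v *)
(* Write w(x) = (1 - x^2)^(nu - 1/2) and let p_d be the Gegenbauer polynomials of
   parameter nu.  The Rodrigues formula suggests that the (i, k) entry of P_n W / w
   is a combination of the p_d, d = i + k - 2 t + n, whose coefficients [phi n t i k]
   are single hypergeometric terms.  For n = 0 these are the coefficients defining W,
   and by x p_d = u_d p_(d+1) + v_d p_(d-1) the claimed recurrence for the matrices
   P_n W / w amounts to a six-term rational identity between the coefficients.

   Hence, if P_n W / w and P_(n-1) W / w have these expansions, then so does T W / w
   for T = x P_n - B_n P_n - C_n P_(n-1).  This expansion involves only p_d with
   d > n, so T is orthogonal to all polynomials of degree at most n.  As T is monic of
   degree n + 1, T - P_(n+1) has degree at most n and is orthogonal to P_0, ..., P_n,
   which forces T = P_(n+1). *)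
Require Import Defs.
From mathcomp Require Import all_boot all_order all_algebra.
From mathcomp Require Import all_classical all_reals all_analysis.
From mathcomp Require Import complex.
From mathcomp Require Import measurable_realfun.
From mathcomp Require Import ring lra zify.
Set Implicit Arguments.
Unset Strict Implicit.
Unset Printing Implicit Defensive.
Import Order.TTheory GRing.Theory Num.Theory.
Import numFieldNormedType.Exports.
Local Open Scope ring_scope.
Local Open Scope complex_scope.

Local Ltac field_side :=
  repeat (apply/andP; split); first [assumption | apply: lt0r_neq0; lra].

(** * Gegenbauer polynomials *)

Section Pochhammer.
Variable R : realType.
Implicit Types (a : R) (n k : nat).

Lemma pochhammer0 a : pochhammer a 0 = 1.
Proof. by rewrite /pochhammer big_ord0. Qed.

Lemma pochhammerS a n : pochhammer a n.+1 = pochhammer a n * (a + n%:R).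
Proof. by rewrite /pochhammer big_ord_recr. Qed.

Lemma pochhammerSl a n : pochhammer a n.+1 = a * pochhammer (a + 1) n.
Proof.
rewrite /pochhammer big_ord_recl addr0; congr (_ * _).
by apply: eq_bigr => i _; rewrite /= /bump /= mulrS addrA.
Qed.

Lemma pochhammer_gt0 a n : 0 < a -> 0 < pochhammer a n.
Proof. by move=> a0; apply: prodr_gt0 => i _; rewrite ltr_wpDr. Qed.

Lemma pochhammer_neq0 a n : 0 < a -> pochhammer a n != 0.
Proof. by move=> a0; rewrite lt0r_neq0 ?pochhammer_gt0. Qed.

Lemma pochhammerNn_eq0 n k : (n < k)%N -> pochhammer (- n%:R : R) k = 0.
Proof.
move=> nk; apply/eqP; rewrite /pochhammer prodf_seq_eq0.
by apply/hasP; exists (Ordinal nk); rewrite ?mem_index_enum//= addNr.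
Qed.

End Pochhammer.

(** * Differential equation and three-term recurrence of the Gegenbauer polynomials *)

Section GegenbauerPoly.
Variables (R : realType) (nu : R).
Hypothesis nu_gt0 : 0 < nu.
Implicit Types (n k : nat) (x : R).

Definition gegen_coef n k : R :=
  pochhammer (- n%:R) k * pochhammer (n%:R + 2 * nu) k /
    (pochhammer (nu + 1 / 2) k * k`!%:R).

(** The terminating series 2F1(-n, n + 2 nu; nu + 1/2; z) as a polynomial in z = (1 - x)/2. *)
Definition gegen_hyp n : {poly R} := \poly_(k < n.+1) gegen_coef n k.

(* The Gegenbauer polynomial, normalised to take the value 1 at 1. *)
Definition gegen_poly n : {poly R} :=
  gegen_hyp n \Po ((1 / 2)%:P * (1 - 'X)).

Lemma coef_gegen_hyp n k : (gegen_hyp n)`_k = gegen_coef n k.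
Proof.
rewrite coef_poly; case: ltnP => // nk.
by rewrite /gegen_coef pochhammerNn_eq0 ?mul0r.
Qed.

Lemma gegen_coefS n k :
  (nu + 1 / 2 + k%:R) * k.+1%:R * gegen_coef n k.+1 =
  (k%:R - n%:R) * (n%:R + 2 * nu + k%:R) * gegen_coef n k.
Proof.
have h0 : 0 < nu + 1 / 2 :> R by rewrite addr_gt0.
have h2 := pochhammer_neq0 k h0.
rewrite /gegen_coef !pochhammerS factS natrM.
have h3 : k`!%:R != 0 :> R by rewrite pnatr_eq0 -lt0n fact_gt0.
have k0 : 0 <= k%:R :> R by [].
by field; field_side.
Qed.

Lemma coefX_deriv (p : {poly R}) k : ('X * p^`())`_k = k%:R * p`_k.
Proof. by case: k => [|k]; rewrite coefXM /= ?mul0r // coef_deriv mulr_natl. Qed.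

(** The hypergeometric equation; on coefficients it is the ratio of consecutive terms. *)
Lemma gegen_hyp_ode n :
  'X * (1 - 'X) * (gegen_hyp n)^`()^`() +
    (nu + 1 / 2)%:P * (1 - 'X *+ 2) * (gegen_hyp n)^`() +
    (n%:R * (n%:R + 2 * nu))%:P * gegen_hyp n = 0.
Proof.
(* With r = z q', the term z^2 q'' is z r' - r, so only operators of the form z d/dz and d/dz
   occur. *)
set q := gegen_hyp n; pose r := 'X * q^`().
have -> : 'X * (1 - 'X) * q^`()^`() + (nu + 1 / 2)%:P * (1 - 'X *+ 2) * q^`() +
    (n%:R * (n%:R + 2 * nu))%:P * q =
   'X * q^`()^`() - ('X * r^`() - r) +
    (nu + 1 / 2)%:P * (q^`() - r *+ 2) + (n%:R * (n%:R + 2 * nu))%:P * q.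
  by rewrite /r derivM derivX; ring.
apply/polyP => k; rewrite coef0 !(coefD, coefN, coefCM, coefMn).
rewrite {}/r !coefX_deriv !coef_deriv !coef_gegen_hyp -[gegen_coef _ _ *+ k.+1]mulr_natl.
transitivity ((nu + 1 / 2 + k%:R) * k.+1%:R * gegen_coef n k.+1 -
  (k%:R - n%:R) * (n%:R + 2 * nu + k%:R) * gegen_coef n k); first by field.
by rewrite gegen_coefS subrr.
Qed.

(* For [n = 0] the junk index [n.-1] is multiplied by 0. *)
Lemma gegen_hyp_rec n :
  (2 * (n%:R + nu))%:P * (1 - 'X *+ 2) * gegen_hyp n =
  (n%:R + 2 * nu)%:P * gegen_hyp n.+1 + n%:R%:P * gegen_hyp n.-1.
Proof.
transitivity ((2 * (n%:R + nu))%:P * (gegen_hyp n - 'X * gegen_hyp n *+ 2)).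
  by ring.
apply/polyP => k; rewrite !(coefD, coefB, coefN, coefMn, coefCM, coefXM).
rewrite !coef_gegen_hyp.
have h0 : 0 < nu + 1 / 2 :> R by rewrite addr_gt0.
case: k => [|k] /=.
  by rewrite /gegen_coef !pochhammer0 fact0; field.
have k0 : 0 <= k%:R :> R by [].
have h2 := pochhammer_neq0 k h0.
have h3 : k`!%:R != 0 :> R by rewrite pnatr_eq0 -lt0n fact_gt0.
(* The term of index n - 1 is put over the Pochhammer factors of index n; for n = 0 both sides
   vanish. *)
have -> : n%:R * gegen_coef n.-1 k.+1 = - (pochhammer (- n%:R) k * (k%:R - n%:R) *
    (k.+1%:R - n%:R) * ((n%:R + 2 * nu - 1) * pochhammer (n%:R + 2 * nu) k)) /
    (pochhammer (nu + 1 / 2) k.+1 * (k.+1)`!%:R).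
  case: n => [|n]; last first.
    rewrite /gegen_coef [pochhammer (n%:R + _) _]pochhammerSl /=.
    have -> : n%:R + 2 * nu + 1 = n.+1%:R + 2 * nu by rewrite -(natr1 n); ring.
    have e1 : - n.+1%:R * pochhammer (- n%:R : R) k.+1 =
      pochhammer (- n.+1%:R) k * (k%:R - n.+1%:R) * (k.+1%:R - n.+1%:R).
      have -> : - n%:R = - n.+1%:R + 1 :> R by rewrite -(natr1 n); ring.
      by rewrite -pochhammerSl !pochhammerS; ring.
    rewrite mulrA (mulrA n.+1%:R) -[n.+1%:R * _]opprK -mulNr e1.
    by congr (_ / _); rewrite -(natr1 n); ring.
  rewrite mul0r; case: k {k0 h2 h3} => [|k].
    by rewrite !pochhammer0 subrr; ring.
  by rewrite pochhammerSl oppr0; ring.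
rewrite /gegen_coef.
rewrite [pochhammer (- n.+1%:R) _]pochhammerSl.
have -> : - n.+1%:R + 1 = - n%:R :> R by rewrite -(natr1 n); ring.
have n0 : 0 <= n%:R :> R by [].
have -> : pochhammer (n.+1%:R + 2 * nu) k.+1 = pochhammer (n%:R + 2 * nu) k *
    (n%:R + 2 * nu + k%:R) * (n%:R + 2 * nu + k.+1%:R) / (n%:R + 2 * nu).
  have -> : n.+1%:R + 2 * nu = n%:R + 2 * nu + 1 by rewrite -(natr1 n); ring.
  rewrite -!pochhammerS [in RHS]pochhammerSl [RHS]mulrC mulKf//.
  by rewrite lt0r_neq0// ltr_wpDl// mulr_gt0.
rewrite !pochhammerS factS natrM.
have nu0 := nu_gt0.
by field; field_side.
Qed.

(** The substitution z = (1 - x)/2 sends 1 - 2 z to x and z (1 - z) to (1 - x^2)/4, which carries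
    the relations for [gegen_hyp] over to [gegen_poly]. *)
Let sub_arg : {poly R} := (1 / 2)%:P * (1 - 'X).

Let comp_sub_arg : (1 - 'X *+ 2) \Po sub_arg = 'X.
Proof.
rewrite comp_polyB comp_polyC raddfMn /= comp_polyX /sub_arg -mulrnAl -polyCMn.
by rewrite (_ : (1 / 2) *+ 2 = 1 :> R) ?mul1r; [ring|field].
Qed.

Let comp_sub_arg2 : ('X * (1 - 'X)) \Po sub_arg = (1 / 4)%:P * (1 - 'X^2).
Proof.
rewrite comp_polyM comp_polyB comp_polyC comp_polyX /sub_arg.
have -> : (1 / 4)%:P = (1 / 2)%:P * (1 / 2)%:P :> {poly R}.
  by rewrite -polyCM; congr (_%:P); field.
have h : (1 / 2)%:P *+ 2 = 1 :> {poly R}.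
  by rewrite -polyCMn; congr (_%:P); field.
rewrite polyC1; set c := _%:P in h *.
have -> : 1 - c * (1 - 'X) = c * (1 + 'X) by rewrite -{1}h; ring.
by ring.
Qed.

Let deriv_sub_arg : sub_arg^`() = (- (1 / 2))%:P.
Proof.
by rewrite /sub_arg derivM derivC mul0r add0r derivB derivX derivC sub0r mulrN1 polyCN.
Qed.

Lemma gegen_poly_rec n : 'X * gegen_poly n =
  ((n%:R + 2 * nu) / (2 * (n%:R + nu))) *: gegen_poly n.+1 +
  (n%:R / (2 * (n%:R + nu))) *: gegen_poly n.-1.
Proof.
have c0 : 2 * (n%:R + nu) != 0 by rewrite mulf_neq0 ?lt0r_neq0 ?ltr_wpDl.
apply: (@scalerI _ _ (2 * (n%:R + nu))) => //.
rewrite scalerDr !scalerA ![2 * _ * (_ / _)]mulrC !divfK//.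
have /(congr1 (fun p => p \Po sub_arg)) := gegen_hyp_rec n.
rewrite comp_polyD !comp_polyM comp_sub_arg !comp_polyC => e.
by rewrite -!mul_polyC mulrA e.
Qed.

Lemma gegen_poly_ode n :
  (1 - 'X^2) * (gegen_poly n)^`()^`() - (2 * nu + 1) *: ('X * (gegen_poly n)^`()) =
  - (n%:R * (n%:R + 2 * nu)) *: gegen_poly n.
Proof.
have /(congr1 (fun p => p \Po sub_arg)) := gegen_hyp_ode n.
rewrite !comp_polyD !(comp_polyM _ (gegen_hyp n)) !(comp_polyM _ _^`()).
rewrite (comp_polyM _%:P) comp_sub_arg comp_sub_arg2.
rewrite comp_poly0 !comp_polyC /gegen_poly -/sub_arg => e.
rewrite !(deriv_comp, deriv_sub_arg, derivM, derivC, mulr0, addr0).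
have h1 : (- (1 / 2))%:P * (- (1 / 2))%:P = (1 / 4)%:P :> {poly R}.
  by rewrite -polyCM; congr (_%:P); field.
have h2 : (2 * nu + 1)%:P * (- (1 / 2))%:P = - (nu + 1 / 2)%:P.
  by rewrite -polyCM -polyCN; congr (_%:P); field.
rewrite scaleNr; apply/eqP; rewrite -addr_eq0 -e -!mul_polyC; apply/eqP.
rewrite -h1 -[(nu + 1 / 2)%:P]opprK -h2; ring.
Qed.

(** Since (-n)_k = 0 for k > n, the partial sums of the hypergeometric series are eventually
    constant. *)
Lemma gegenbauerE n x :
  gegenbauer nu n x = pochhammer (2 * nu) n / n`!%:R * (gegen_poly n).[x].
Proof.
rewrite /gegenbauer; congr (_ * _).
rewrite horner_comp !hornerE horner_poly /hypergeometric2F1.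
apply: lim_near_cst => //; exists n.+1 => // N /= nN.
rewrite /series /= (big_cat_nat (n := n.+1))//=.
rewrite [X in _ + X]big_nat_cond [X in _ + X]big1 ?addr0 ?big_mkord.
  by apply: eq_bigr => i _; rewrite /gegen_coef !div1r.
by move=> k /andP[/andP[nk _] _]; rewrite pochhammerNn_eq0 ?mul0r.
Qed.

End GegenbauerPoly.

(** * The coefficients of P_n W and their recurrence *)

Section WeightCoefficients.
Variables (R : realType) (L : nat) (nu : R).
Hypothesis nu_gt0 : 0 < nu.
Implicit Types (n t s i j k a b c : nat).

Local Notation G := (pochhammer nu).

(* [phi n t i k] is the coefficient of [gegen_poly nu (i + k - 2 t + n)] in the
   Rodrigues-type expansion of the (i, k) entry of P_n W / (1 - x^2)^(nu - 1/2).
   It is a constant depending on n and i times alpha_t(i, k) (2 nu)_d / d!, where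
   d = i + k - 2 t, taken with nu + n in place of nu.  With a = i - t, b = k - t and c = L + t - i - k, which sum with t to L,
   [phi_outer] gathers the factors independent of t. *)
Definition phi_outer n i j k : R :=
  (i`! * k`! * j`! * (L - k)`!)%:R / L`!%:R / 2 ^+ n *
  (pochhammer (L%:R + 2 * nu) n * (L%:R + nu) * G (n + L).+1) *
  (G j * G i / (G (n + j) * G (n + i))).

Definition phi_inner n t a b c : R :=
  ((a + b + n)%:R + nu) * (G (n + a) * G (n + b)) /
  (G (n + a + b + t).+1 * G (n + a + b + c).+1) /
  (t`! * a`! * b`! * c`!)%:R.

Definition phi n t i k : R :=
  if [&& t <= i, t <= k & i + k <= L + t]%N
  then phi_outer n i (L - i) k * phi_inner n t (i - t) (k - t) (L + t - (i + k))
  else 0.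

Let natr_nneg n : 0 <= n%:R :> R. Proof. by []. Qed.
Let G_neq0 n : G n != 0. Proof. exact: pochhammer_neq0. Qed.
Let fact_neq0 n : n`!%:R != 0 :> R.
Proof. by rewrite pnatr_eq0 -lt0n fact_gt0. Qed.
Let nuD_neq0 n : nu + n%:R != 0. Proof. by rewrite gt_eqF// ltr_wpDr. Qed.

Let two_exp_neq0 n : 2 ^+ n != 0 :> R. Proof. by rewrite expf_neq0. Qed.

Local Ltac nu_field n i j :=
  field; have nu0 := nu_gt0; have n0 := natr_nneg n; have i0 := natr_nneg i;
  have j0 := natr_nneg j; repeat (apply/andP; split);
  first [done | apply: G_neq0 | apply: fact_neq0 | apply: two_exp_neq0
        | apply: lt0r_neq0; lra].

(** Ratios of neighbouring values of [phi_outer]: here in n, next under a transfer of one unit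
    between i and j = L - i, combined with an entry of B_n. They reduce all terms of the recurrence
    to one factor. *)
Lemma phi_outerS n i j k : phi_outer n.+1 i j k =
  phi_outer n i j k * ((L%:R + 2 * nu + n%:R) * (nu + (n + L).+1%:R) /
    (2 * (nu + (n + j)%:R) * (nu + (n + i)%:R))).
Proof.
rewrite /phi_outer !addSn !pochhammerS exprS.
by nu_field n i j.
Qed.

Lemma phi_outer_pred n i j k :
  (i.+1%:R * (i.+1%:R + nu - 1) /
     (2 * (i.+1%:R + n%:R + nu - 1) * (i.+1%:R + n%:R + nu))) *
    phi_outer n i j.+1 k =
  phi_outer n i.+1 j k * (j.+1%:R * (nu + j%:R) /
    (2 * (nu + (n + i).+1%:R) * (nu + (n + j)%:R))).
Proof.
rewrite /phi_outer !addnS !pochhammerS !factS !natrM.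
by nu_field n i j.
Qed.

Lemma phi_outer_succ n i j k :
  (j.+1%:R * (j.+1%:R + nu - 1) /
     (2 * (j.+1%:R + n%:R + nu - 1) * (j.+1%:R + n%:R + nu))) *
    phi_outer n i.+1 j k =
  phi_outer n i j.+1 k * (i.+1%:R * (nu + i%:R) /
    (2 * (nu + (n + j).+1%:R) * (nu + (n + i)%:R))).
Proof.
rewrite /phi_outer !addnS !pochhammerS !factS !natrM.
by nu_field n i j.
Qed.

(* The six values of [phi_inner] met in the recurrence are [phi_common] times a
   polynomial.  Here [s] and [c] exceed by one the corresponding arguments of the
   value at (t, a, b, c) = (s - 1, a, b, c - 1), so that the polynomial vanishes
   when an argument is out of range. *)
Definition phi_common n s a b c : R :=
  (G (n + a + b + s) * G (n + a + b + c) * (s`! * a`! * b`! * c`!)%:R)^-1.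

(** One lemma for each term of the recurrence: [down] and [up] are the two parts of x p_d, [pred]
    and [succ] the rows i - 1 and i + 1 met through B_n, [next] and [prev] the indices n + 1 and n -
    1. *)
Lemma phi_inner_down n s a b c :
  phi_inner n s a b c * ((n + a + b)%:R / (2 * ((n + a + b)%:R + nu))) =
  phi_common n s.+1 a b c.+1 * (s.+1%:R * c.+1%:R * (n + a + b)%:R / 2 *
    (G (n + a) * G (n + b))).
Proof.
rewrite /phi_inner /phi_common !addnS !factS !natrM.
have h := natr_nneg c; have h1 := natr_nneg s; by nu_field n a b.
Qed.

Lemma phi_inner_up n s a b c :
  phi_inner n s a b c *
    (((n + a + b)%:R + 2 * nu) / (2 * ((n + a + b)%:R + nu))) =
  phi_common n s a.+1 b.+1 c * (a.+1%:R * b.+1%:R *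
    ((n + a + b)%:R + 2 * nu) / 2 *
    (nu + (n + a + b + s).+1%:R) * (nu + (n + a + b + c).+1%:R) *
    (G (n + a) * G (n + b))).
Proof.
rewrite /phi_inner /phi_common !(addnS, addSn) !pochhammerS !factS !natrM.
have h := natr_nneg c; have h1 := natr_nneg s; by nu_field n a b.
Qed.

Lemma phi_inner_pred n s a b c :
  phi_inner n s a b c =
  phi_common n s.+1 a.+1 b c * (s.+1%:R * a.+1%:R * ((a + b + n)%:R + nu) *
    (nu + (n + a + b + s).+1%:R) * (G (n + a) * G (n + b))).
Proof.
rewrite /phi_inner /phi_common !(addnS, addSn) !pochhammerS !factS !natrM.
have h := natr_nneg c; have h1 := natr_nneg s; by nu_field n a b.
Qed.

Lemma phi_inner_succ n s a b c :
  phi_inner n s a b c =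
  phi_common n s a b.+1 c.+1 * (b.+1%:R * c.+1%:R * ((a + b + n)%:R + nu) *
    (nu + (n + a + b + c).+1%:R) * (G (n + a) * G (n + b))).
Proof.
rewrite /phi_inner /phi_common !(addnS, addSn) !pochhammerS !factS !natrM.
have h := natr_nneg c; have h1 := natr_nneg s; by nu_field n a b.
Qed.

Lemma phi_inner_next n s a b c :
  phi_inner n.+1 s a b c =
  phi_common n s a.+1 b.+1 c * (a.+1%:R * b.+1%:R * ((a + b + n).+1%:R + nu) *
    (G (n + a.+1) * G (n + b.+1))).
Proof.
rewrite /phi_inner /phi_common !(addnS, addSn) !pochhammerS !factS !natrM.
have h := natr_nneg c; have h1 := natr_nneg s; by nu_field n a b.
Qed.

Lemma phi_inner_prev n s a b c :
  phi_inner n s a b c =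
  phi_common n.+1 s.+1 a b c.+1 * (s.+1%:R * c.+1%:R * ((a + b + n)%:R + nu) *
    (nu + (n + a + b + s).+1%:R) * (nu + (n + a + b + c).+1%:R) *
    (G (n + a) * G (n + b))).
Proof.
rewrite /phi_inner /phi_common !(addnS, addSn) !pochhammerS !factS !natrM.
have h := natr_nneg c; have h1 := natr_nneg s; by nu_field n a b.
Qed.

Lemma phiE n t i k a b c :
  i = (t + a)%N -> k = (t + b)%N -> (L + t = i + k + c)%N ->
  phi n t i k = phi_outer n i (L - i) k * phi_inner n t a b c.
Proof.
move=> -> -> e; rewrite /phi !leq_addr !addKn e leq_addr /=.
by rewrite addKn.
Qed.

(** The default 0 outside the range lets sums over t run over fixed bounds. *)
Lemma phi_eq0 n t i k :
  [|| i < t, k < t | L + t < i + k]%N -> phi n t i k = 0.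
Proof.
by move=> h; rewrite /phi; case: ifP => // /and3P[]; case/or3P: h; lia.
Qed.

(** Coefficients are collected by the Gegenbauer index i + k + n + 1 - 2 s. The lowering part of x
    p_d, the row i - 1 and P_(n-1) contribute to it at t = s - 1, hence not at all for s = 0. *)
Definition phi_pred n s i k : R := if s is t.+1 then phi n t i k else 0.

(** The entry (i, i - 1) of B_n; by the symmetry exchanging i and L - i, the entry (i, i + 1) is
    [recB_sub n (L - i)]. *)
Definition recB_sub n i : R :=
  i%:R * (i%:R + nu - 1) / (2 * (i%:R + n%:R + nu - 1) * (i%:R + n%:R + nu)).

Definition recC_diag n i : R :=
  n%:R * (n%:R + nu - 1) * (L%:R + n%:R + nu) * (L%:R + n%:R + 2 * nu - 1) /
  (4 * (L%:R + n%:R + nu - i%:R - 1) * (L%:R + n%:R + nu - i%:R) *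
     (i%:R + n%:R + nu - 1) * (i%:R + n%:R + nu)).

(** Comparison of coefficients at the index i + k + n + 1 - 2 s. After division by a common factor
    it is an identity of rational functions. *)
Lemma phi_rec n s i k : (i <= L)%N -> (k <= L)%N ->
  phi n s i k * (((i + k - s.*2 + n)%:R + 2 * nu) /
    (2 * ((i + k - s.*2 + n)%:R + nu))) +
  phi_pred n s i k * ((i + k + 2 - s.*2 + n)%:R /
    (2 * ((i + k + 2 - s.*2 + n)%:R + nu))) =
  phi n.+1 s i k +
  (if i is i'.+1 then recB_sub n i * phi_pred n s i' k else 0) +
  (if (i < L)%N then recB_sub n (L - i) * phi n s i.+1 k else 0) +
  (if n is n'.+1 then recC_diag n i * phi_pred n' s i k else 0).
Proof.
move=> iL kL.
(* Outside this range of s every term vanishes. *)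
have [sc|] := boolP [&& s <= i.+1, s <= k.+1 & i + k <= L + s]%N; last first.
  rewrite !negb_and -!ltnNge => sc.
  have pphi0 m i' k' : [|| i'.+1 < s, k'.+1 < s | L + s <= i' + k']%N ->
      phi_pred m s i' k' = 0.
    by rewrite /phi_pred; case: (s) => // t h; apply: phi_eq0; lia.
  rewrite !phi_eq0 ?pphi0 ?mul0r; try lia.
  rewrite !add0r; case: i {iL} sc => [|i'] sc; rewrite ?pphi0; try lia.
    by case: ifP; case: n => [|n']; rewrite ?pphi0 ?mulr0 ?addr0//; lia.
  by case: ifP; case: n => [|n']; rewrite ?pphi0 ?mulr0 ?addr0//; lia.
case/and3P: sc => si sk sc.
(* Here a and b are i - t and k - t for t = s - 1, but c belongs to t = s. A term out of range then
   shows up as a vanishing factor s, a, b or c. *)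
pose a := (i.+1 - s)%N; pose b := (k.+1 - s)%N; pose c := (L + s - (i + k))%N.
pose j := (L - i)%N.
have ia : i.+1 = (s + a)%N by rewrite /a; lia.
have kb : k.+1 = (s + b)%N by rewrite /b; lia.
have jc : j.+1 = (b + c)%N by rewrite /j /b /c; lia.
have Lij : L = (i + j)%N by rewrite /j; lia.
have jE : (L - i)%N = j by [].
have cE : (L + s - (i + k))%N = c by [].
clearbody a b c j.
pose E := phi_outer n i j k; pose K := phi_common n s a b c.
(* For n + a = 0 the truncated predecessor gives [G 0]; this is harmless, as [Ha] occurs only
   multiplied by a or n. Likewise for [Hb] with b or n. *)
pose Ha := G (n + a).-1; pose Hb := G (n + b).-1.
pose S := nu + (n + a + b + s)%:R - 1; pose C := nu + (n + a + b + c)%:R - 1.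
have up : phi n s i k * (((i + k - s.*2 + n)%:R + 2 * nu) /
    (2 * ((i + k - s.*2 + n)%:R + nu))) =
    E * K * (a%:R * b%:R * ((n + a + b)%:R - 2 + 2 * nu) / 2 * S * C * (Ha * Hb)).
  rewrite /E /K /Ha /Hb /S /C.
  case: (a) ia => [|a'] ia'; first by rewrite phi_eq0 ?mul0r ?mulr0//; lia.
  case: (b) kb => [|b'] kb'; first by rewrite phi_eq0 ?mulr0 ?mul0r ?mulr0//; lia.
  rewrite (@phiE n s i k a' b' c); try lia.
  have -> : (i + k - s.*2 + n = n + a' + b')%N by lia.
  rewrite jE -mulrA phi_inner_up !(addnS, addSn) /=.
  by move: (phi_outer _ _ _ _) (phi_common _ _ _ _ _) => x y; field.
have down : phi_pred n s i k * ((i + k + 2 - s.*2 + n)%:R /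
      (2 * ((i + k + 2 - s.*2 + n)%:R + nu))) =
    E * K * (s%:R * c%:R * (n + a + b)%:R / 2 * (G (n + a) * G (n + b))).
  rewrite /E /K /phi_pred.
  case: (s) ia kb jc sc => [|t] ia' kb' jc' sc'; first by rewrite !mul0r mulr0.
  case: (c) jc' => [|c'] jc''; first by rewrite phi_eq0 ?mulr0 ?mul0r ?mulr0//; lia.
  rewrite (@phiE n t i k a b c'); try lia.
  have -> : (i + k + 2 - t.+1.*2 + n = n + a + b)%N by lia.
  by rewrite jE -mulrA phi_inner_down mulrA.
have next : phi n.+1 s i k = E * K * (((L%:R + 2 * nu + n%:R) *
      (nu + (n + L).+1%:R) / (2 * (nu + (n + j)%:R) * (nu + (n + i)%:R))) *
      (a%:R * b%:R * ((a + b + n)%:R - 1 + nu) * (G (n + a) * G (n + b)))).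
  rewrite /E /K.
  case: (a) ia => [|a'] ia'; first by rewrite phi_eq0 ?mul0r ?mulr0//; lia.
  case: (b) kb => [|b'] kb'.
    by rewrite phi_eq0 ?(mulr0, mul0r)//; lia.
  rewrite (@phiE n.+1 s i k a' b' c); try lia.
  rewrite jE phi_outerS phi_inner_next !(addnS, addSn).
  move: (phi_outer _ _ _ _) (phi_common _ _ _ _ _) => x y.
  by nu_field n i j.
have pred : (if i is i'.+1 then recB_sub n i * phi_pred n s i' k else 0) =
    E * K * ((j.+1%:R * (nu + j%:R) / (2 * (nu + (n + i)%:R) * (nu + (n + j)%:R))) *
      (s%:R * a%:R * ((a + b + n)%:R - 1 + nu) * S * (Ha * G (n + b)))).
  rewrite /E /K /Ha /S.
  case: (i) ia jE Lij cE => [|i'] ia' jE' Lij' cE'.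
    (* Row 0 has no left neighbour, and s + a = 1 makes the right-hand side vanish too. *)
    have [->|->] : (s = 0 \/ a = 0)%N by lia.
      by rewrite ?(mul0r, mulr0).
    by rewrite ?(mul0r, mulr0).
  case: (s) ia' kb cE' => [|t] ia'' kb' cE''; first by rewrite /= ?(mulr0, mul0r).
  case: (a) ia'' => [|a'] ia''.
    by rewrite /= phi_eq0 ?(mulr0, mul0r)//; lia.
  rewrite /= (@phiE n t i' k a' b c); try lia.
  have -> : (L - i' = j.+1)%N by lia.
  rewrite mulrA phi_outer_pred phi_inner_pred !(addnS, addSn) /=.
  move: (phi_outer _ _ _ _) (phi_common _ _ _ _ _) => x y.
  by nu_field n i' j.
have succ : (if (i < L)%N then recB_sub n (L - i) * phi n s i.+1 k else 0) =
    E * K * ((i.+1%:R * (nu + i%:R) / (2 * (nu + (n + j)%:R) * (nu + (n + i)%:R))) *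
      (b%:R * c%:R * ((a + b + n)%:R - 1 + nu) * C * (G (n + a) * Hb))).
  rewrite jE /E /K /Hb /C.
  case: ltnP => [iL'|]; last first.
    move=> Li; have [->|->] : (b = 0 \/ c = 0)%N by lia.
      by rewrite ?(mul0r, mulr0).
    by rewrite ?(mul0r, mulr0).
  case: (j) jc jE Lij => [|j'] jc' jE' Lij'; first by lia.
  case: (b) kb jc' => [|b'] kb' jc''; first by rewrite phi_eq0 ?(mulr0, mul0r)//; lia.
  case: (c) cE jc'' => [|c'] cE' jc''; first by rewrite phi_eq0 ?(mulr0, mul0r)//; lia.
  rewrite (@phiE n s i.+1 k a b' c'); try lia.
  have -> : (L - i.+1 = j')%N by lia.
  rewrite mulrA phi_outer_succ phi_inner_succ !(addnS, addSn) /=.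
  move: (phi_outer _ _ _ _) (phi_common _ _ _ _ _) => x y.
  by nu_field n i j'.
have prev : (if n is n'.+1 then recC_diag n i * phi_pred n' s i k else 0) =
    E * K * (n%:R * (n%:R + nu - 1) / (2 * (nu + (n + j)%:R) * (nu + (n + i)%:R)) *
      (s%:R * c%:R * ((a + b + n)%:R - 1 + nu) * S * C * (Ha * Hb))).
  rewrite /E /K /Ha /Hb /S /C.
  case: (n) => [|n']; first by rewrite ?(mul0r, mulr0).
  case: (s) ia kb cE => [|t] ia' kb' cE' /=; first by rewrite ?(mul0r, mulr0).
  case: (c) cE' => [|c'] cE'; first by rewrite phi_eq0 ?(mulr0, mul0r)//; lia.
  rewrite (@phiE n' t i k a b c'); try lia.
  rewrite jE phi_outerS phi_inner_prev !(addnS, addSn) /= /recC_diag Lij.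
  move: (phi_outer _ _ _ _) (phi_common _ _ _ _ _) => x y.
  by nu_field n' i j.
rewrite up down next pred succ prev -!mulrDr; congr (_ * _).
clear up down next pred succ prev.
have i0 := natr_nneg i; have j0 := natr_nneg j.
have n0 := natr_nneg n; have nu0 := nu_gt0.
have iE : s%:R = i%:R + 1 - a%:R :> R.
  by rewrite natr1 ia natrD addrK.
have cjE : c%:R = j%:R + 1 - b%:R :> R.
  by rewrite natr1 jc natrD addrAC subrr add0r.
have LE : L%:R = i%:R + j%:R :> R by rewrite Lij natrD.
have GS m : (0 < m)%N -> G m = G m.-1 * (nu + m%:R - 1).
  by case: m => // m _; rewrite pochhammerS -natr1 addrA addrK.
have nz1 : nu + (n + j)%:R != 0 := nuD_neq0 _.
have nz2 : nu + (n + i)%:R != 0 := nuD_neq0 _.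
rewrite {}/S {}/C -(natr1 i) -(natr1 j) -(natr1 (n + L)) !natrD iE cjE LE in nz1 nz2 *.
(* The factorisation of G m through G (m - 1) requires m > 0, hence four cases. *)
have [na|] := posnP (n + a); have [nb|] := posnP (n + b).
- have [n00 a0 b0] : [/\ n = 0%N, a = 0%N & b = 0%N] by split; lia.
  rewrite n00 a0 b0.
  by field; field_side.
- move=> nb; rewrite (GS _ nb) -/Hb.
  have [n00 a0] : (n = 0 /\ a = 0)%N by lia.
  rewrite n00 a0 /= in nz1 nz2 *.
  by rewrite natrD; field; field_side.
- move=> na; rewrite (GS _ na) -/Ha.
  have [n00 b0] : (n = 0 /\ b = 0)%N by lia.
  rewrite n00 b0 /= in nz1 nz2 *.
  by rewrite natrD; field; field_side.
move=> nb na; rewrite (GS _ nb) (GS _ na) -/Ha -/Hb !natrD.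
by field; field_side.
Qed.

End WeightCoefficients.

(** * Integration against the Gegenbauer weight *)

Section OpenIntervalFTC.
Local Open Scope classical_set_scope.
Local Open Scope ring_scope.
Variable R : realType.
Local Notation mu := (@lebesgue_measure R).
Implicit Types (f F : R -> R) (a b M : R).

Let in_itvoo_continuous_measurable f a b :
  {in `]a, b[, continuous f} -> measurable_fun `]a, b[ f.
Proof.
by move=> cf; apply: open_continuous_measurable_fun => //; apply/in_setP => x /cf.
Qed.

(** On [a + h, b - h] the integral of f is F(b - h) - F(a + h), at most 2 M; monotone convergence
    passes to the open interval. *)
Lemma ge0_integrable_oo_of_bounded_primitive f F a b M : a < b ->
  {in `]a, b[, forall x, 0 <= f x} ->
  {in `]a, b[, continuous f} ->
  {in `]a, b[, forall x : R, is_derive x (1 : R) F (f x)} ->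
  {in `]a, b[, forall x, `|F x| <= M} ->
  mu.-integrable `]a, b[ (EFin \o f).
Proof.
move=> ab f0 cf dF FM.
(* The denominator n + 3 keeps h at most (b - a)/3, so that a + h < b - h already for n = 0. *)
pose h n : R := (b - a) / n.+3%:R.
have ba0 : 0 < b - a by rewrite subr_gt0.
have h_gt0 n : 0 < h n by rewrite divr_gt0.
have ahbh n : a + h n < b - h n.
  have : h n * 3 <= b - a.
    by rewrite /h mulrAC ler_pdivrMr// ler_pM2l// ler_nat.
  by have := h_gt0 n; lra.
pose I n : set R := `[a + h n, b - h n]%classic.
have sub n x : x \in `[a + h n, b - h n] -> x \in `]a, b[.
  rewrite !in_itv/= => /andP[x1 x2]; have := h_gt0 n => hn.
  by apply/andP; split; lra.
have ndI : nondecreasing_seq I.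
  apply/nondecreasing_seqP => n; rewrite subsetEset; apply: subset_itv.
    by rewrite bnd_simp lerD2l ler_pM2l// lef_pV2 ?posrE// ler_nat.
  by rewrite bnd_simp lerD2l lerN2 ler_pM2l// lef_pV2 ?posrE// ler_nat.
have UI : \bigcup_n I n = `]a, b[%classic.
  apply/seteqP; split=> [x [n _]|x]; first exact: sub.
  rewrite /= in_itv/= => /andP[ax xb].
  pose e := Num.min (x - a) (b - x).
  have e0 : 0 < e by rewrite lt_min !subr_gt0 ax.
  exists (Num.truncn ((b - a) / e)) => //=; set n := Num.truncn _.
  have he : h n <= e.
    rewrite ler_pdivrMr// mulrC -ler_pdivrMr//.
    by apply/ltW/(lt_le_trans (truncnS_gt _)); rewrite ler_nat -/n; lia.
  by move: he; rewrite le_min /I /= in_itv/= => /andP[? ?]; apply/andP; split; lra.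
have mf := in_itvoo_continuous_measurable cf.
apply/integrableP; split; first exact/measurable_EFinP.
rewrite (_ : (\int[mu]_(x in _) _ = \int[mu]_(x in `]a, b[) (f x)%:E)%E); last first.
  by apply: eq_integral => x; rewrite inE/= => /f0 ?; rewrite ger0_norm.
have mI n : measurable (I n) by exact: measurable_itv.
have mfI n : measurable_fun (I n) (EFin \o f).
  apply/measurable_EFinP; apply: measurable_funS mf => //.
  by move=> x; exact: sub.
have fI0 n x : I n x -> (0 <= (EFin \o f) x)%E.
  by move=> /sub/f0; rewrite lee_fin.
have cvI : (\int[mu]_(x in I n) (f x)%:E @[n --> \oo] -->
    \int[mu]_(x in `]a, b[) (f x)%:E)%E.
  by rewrite -UI; exact: ge0_nondecreasing_set_cvg_integral.
apply: (@le_lt_trans _ _ (M + M)%:E); last exact: ltry.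
rewrite -(cvg_lim _ cvI)//; apply: lime_le; first by apply/cvg_ex; eexists; exact: cvI.
apply: nearW => n /=.
have cF : {in `]a, b[, continuous F}.
  move=> x /dF dFx; apply/differentiable_continuous/derivable1_diffP.
  exact: ex_derive.
have ina : a + h n \in `]a, b[ by apply: (sub n); rewrite in_itv/= lexx ltW.
have inb : b - h n \in `]a, b[ by apply: (sub n); rewrite in_itv/= lexx andbT ltW.
rewrite (@continuous_FTC2 _ f F)//.
- rewrite -EFinB lee_fin (le_trans (ler_norm _))// (le_trans (ler_normB _ _))//.
  by rewrite lerD// FM.
- apply: continuous_in_subspaceT => x; rewrite inE => /sub; exact: cf.
- split=> [x xI||].
  + by apply: ex_derive; apply: dF; apply: (sub n); exact: subset_itv_oo_cc xI.
  + exact/cvg_at_right_filter/cF.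
  + exact/cvg_at_left_filter/cF.
- by move=> x xI; rewrite derive1E; apply: derive_val; apply: dF;
    apply: (sub n); exact: subset_itv_oo_cc xI.
Qed.

(** The indefinite integral of f and F are both continuous on [a, b] with derivative f inside, so
    the mean value theorem makes their difference constant. *)
Lemma integrable_FTC2_oo f F a b : a < b ->
  mu.-integrable `]a, b[ (EFin \o f) ->
  {in `]a, b[, continuous f} ->
  {in `]a, b[, forall x : R, is_derive x (1 : R) F (f x)} ->
  {within `[a, b], continuous F} ->
  \int[mu]_(x in `]a, b[) f x = F b - F a.
Proof.
move=> ab fi cf dF cF.
have fi' : mu.-integrable `[a, b] (EFin \o f).
  have /integrableP[mf fy] := fi.
  apply/integrableP; split.
    exact/emeasurable_fun_itv_bndo_bndcP/emeasurable_fun_itv_obnd_cbndP.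
  by rewrite integral_itv_bndoo//; exact: measurableT_comp.
pose G x := \int[mu]_(t in `[a, x]) f t.
have cG : {within `[a, b], continuous G}.
  by have := parameterized_integral_continuous (ltW ab) fi'.
have dG x : x \in `]a, b[ -> is_derive x (1 : R) G (f x).
  move=> xab; have := xab; rewrite in_itv/= => /andP[ax xb].
  have [] := continuous_FTC1_closed xb fi' ax (cf _ xab).
  by rewrite derive1E => dG <-; exact/derivableP.
have [] := @MVT R (G \- F) (f \- f) a b ab.
- by move=> x xab; apply: is_deriveB; [exact: dG|exact: dF].
- by move=> x; apply: cvgB; [exact: cG|exact: cF].
move=> c _; rewrite /= subrr mul0r.
have -> : G a = 0 by rewrite /G set_itv1 Rintegral_set1.
rewrite sub0r opprK => /eqP; rewrite addr_eq0 subr_eq addrC => /eqP <-.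
rewrite /G /Rintegral [in RHS]integral_itv_bndoo//.
by apply/measurable_EFinP; exact: (in_itvoo_continuous_measurable cf).
Qed.

End OpenIntervalFTC.

(** * Orthogonality of the scalar Gegenbauer polynomials *)

Section GegenbauerIntegral.
Local Open Scope classical_set_scope.
Local Open Scope ring_scope.
Variables (R : realType) (nu : R).
Hypothesis nu_gt0 : 0 < nu.
Local Notation mu := (@lebesgue_measure R).
Implicit Types (p q : {poly R}) (x : R).

Definition gegen_weight x : R := (1 - x ^+ 2) `^ (nu - 1 / 2).

Definition gegen_int p : R :=
  \int[mu]_(x in `]-1, 1[) (gegen_weight x * p.[x]).

Let sqr_lt1 x : x \in `]-1, 1[ -> 0 < 1 - x ^+ 2 <= 1.
Proof.
rewrite in_itv/= => /andP[x1 x2]; rewrite gerBl sqr_ge0 andbT.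
by rewrite (_ : 1 - x ^+ 2 = (1 - x) * (1 + x)) ?mulr_gt0//; [lra|lra|ring].
Qed.

Lemma is_derive_horner p x : is_derive x (1 : R) (horner p) p^`().[x].
Proof. by rewrite derivE derive1E; apply/derivableP/derivable_horner. Qed.

Let is_derive_arg x : is_derive x (1 : R) (fun y : R => 1 - y ^+ 2) (- (2 * x)).
Proof.
have -> : (fun y : R => 1 - y ^+ 2) = horner (1 - 'X^2).
  by apply/funext => y; rewrite !hornerE.
have -> : - (2 * x) = (1 - 'X^2)^`().[x].
  by rewrite derivB derivC derivXn !hornerE mulr_natl.
exact: is_derive_horner.
Qed.

Lemma is_derive_gegen_powR (r x : R) : x \in `]-1, 1[ ->
  is_derive x (1 : R) (fun y : R => (1 - y ^+ 2) `^ r)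
    (- (2 * x) * (r * (1 - x ^+ 2) `^ (r - 1))).
Proof.
move=> /sqr_lt1/andP[x0 _].
have := @is_derive1_comp R (fun y => y `^ r) (fun y => 1 - y ^+ 2) x _ _
  (is_derive1_powR r x0) (is_derive_arg x).
by rewrite mulrC.
Qed.

Lemma gegen_powR_continuous (r : R) :
  {in `]-1, 1[, continuous (fun x : R => (1 - x ^+ 2) `^ r)}.
Proof.
move=> x x1; apply/differentiable_continuous/derivable1_diffP.
by apply: ex_derive; exact: is_derive_gegen_powR.
Qed.

(** As nu - 1/2 >= -1/2 and 0 < 1 - x^2 <= 1, the weight is at most (1 - x^2)^(-1/2), the derivative
    of the bounded function arcsin. *)
Lemma integrable_gegen_weight : mu.-integrable `]-1, 1[ (EFin \o gegen_weight).
Proof.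
have asin_int : mu.-integrable `]-1, 1[
    (EFin \o (fun x : R => (1 - x ^+ 2) `^ (- 2^-1))).
  apply: (@ge0_integrable_oo_of_bounded_primitive _ _ (@asin R) _ _ (pi / 2)).
  - by lra.
  - by move=> x _; exact: powR_ge0.
  - exact: gegen_powR_continuous.
  - move=> x x1; have /andP[y0 _] := sqr_lt1 x1.
    rewrite powRN powR12_sqrt ?(ltW y0)//; apply: is_derive1_asin.
    by move: x1; rewrite in_itv.
  - move=> x; rewrite in_itv/= => /andP[x1 x2]; rewrite ler_norml.
    by rewrite asin_geNpi2 ?asin_lepi2 ?(ltW x1) ?(ltW x2).
apply: le_integrable asin_int => //.
- apply/measurable_EFinP; apply: open_continuous_measurable_fun => //.
  by apply/in_setP => x x1; exact: gegen_powR_continuous.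
- move=> x /= x1; have /andP[y0 y1] := sqr_lt1 x1.
  rewrite lee_fin !ger0_norm ?powR_ge0//.
  by apply: ger_powR; rewrite ?y0//; have := nu_gt0; lra.
Qed.

Let horner_continuous p : continuous (horner p).
Proof.
by move=> x; apply/differentiable_continuous/derivable1_diffP/derivable_horner.
Qed.

Lemma integrable_gegen_weight_poly p :
  mu.-integrable `]-1, 1[ (EFin \o (fun x => gegen_weight x * p.[x])).
Proof.
have cp := @horner_continuous p.
have := integrableMl _ integrable_gegen_weight _ _; apply => //.
- by apply: measurable_funTS; exact: continuous_measurable_fun.
- have /compact_bounded[M [Mr hM]] := continuous_compact
    (continuous_subspaceT cp) (@segment_compact R (-1) 1).
  exists M; split=> // N MN x /= x1; apply: (hM N MN); exists x => //.
  exact: subset_itv_oo_cc x1.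
Qed.

Lemma gegen_intD p q : gegen_int (p + q) = gegen_int p + gegen_int q.
Proof.
rewrite /gegen_int -RintegralD//; first 1 last.
- exact: integrable_gegen_weight_poly.
- exact: integrable_gegen_weight_poly.
by apply: eq_Rintegral => x _; rewrite hornerD mulrDr.
Qed.

Lemma gegen_intZ (c : R) p : gegen_int (c *: p) = c * gegen_int p.
Proof.
rewrite /gegen_int -RintegralZl//; last exact: integrable_gegen_weight_poly.
by apply: eq_Rintegral => x _; rewrite hornerZ mulrCA.
Qed.

(** Times the weight, this polynomial is the derivative of (1 - x^2)^(nu + 1/2) p, which vanishes at
    both ends. *)
Lemma gegen_int_deriv p :
  gegen_int ((1 - 'X^2) * p^`() - (2 * nu + 1) *: ('X * p)) = 0.
Proof.
have cp := @horner_continuous p.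
have arg_continuous : continuous (fun x : R => 1 - x ^+ 2).
  by move=> x; apply/differentiable_continuous/derivable1_diffP; exact: ex_derive.
have arg_edge (x : R) : x ^+ 2 = 1 ^+ 2 -> 1 - x ^+ 2 = 0.
  by move=> ->; rewrite expr1n subrr.
(* The power is squeezed between 0 and sqrt(1 - x^2), because nu + 1/2 >= 1/2. *)
have edge (F : set_system R) : Filter F ->
    (\forall x \near F, x \in `]-1, 1[) -> (1 - x ^+ 2) @[x --> F] --> 0 ->
    (1 - x ^+ 2) `^ (nu + 1 / 2) @[x --> F] --> 0.
  move=> FF F1 F0.
  apply: (@squeeze_cvgr _ _ _ _ (fun=> 0) (fun x : R => Num.sqrt (1 - x ^+ 2))).
  - near=> x; have /andP[y0 y1] : 0 < 1 - x ^+ 2 <= 1.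
      by apply: sqr_lt1; near: x.
    rewrite powR_ge0/= -powR12_sqrt ?(ltW y0)//.
    by apply: ger_powR; rewrite ?y0//; have := nu_gt0; lra.
  - exact: cvg_cst.
  - rewrite -(@sqrtr0 R); apply: cvg_comp F0 _; exact: sqrt_continuous.
rewrite /gegen_int.
rewrite (@integrable_FTC2_oo _ _ (fun x => (1 - x ^+ 2) `^ (nu + 1 / 2) * p.[x])).
- by rewrite expr1n sqrrN expr1n subrr powR0 ?mul0r ?subrr//; have := nu_gt0; lra.
- by lra.
- exact: integrable_gegen_weight_poly.
- move=> x x1; apply: cvgM; first exact: gegen_powR_continuous.
  exact/differentiable_continuous/derivable1_diffP/derivable_horner.
- move=> x x1; have /andP[y0 _] := sqr_lt1 x1.
  have d1 := is_derive_gegen_powR (nu + 1 / 2) x1; have d2 := is_derive_horner p x.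
  apply: (is_derive_eq (is_deriveM d1 d2)).
  have e : (1 - x ^+ 2) `^ (nu + 1 / 2) = (1 - x ^+ 2) * gegen_weight x.
    rewrite -mulr_powRB1 ?(ltW y0)//; last by have := nu_gt0; lra.
    by congr (_ * _ `^ _); field.
  have e' : nu + 1 / 2 - 1 = nu - 1 / 2 by field.
  rewrite e e' -/(gegen_weight x) !hornerE /GRing.scale /=.
  by field.
- apply: derivable_oo_LRcontinuous_within; split.
  + move=> x x1; apply: derivableM; last exact: derivable_horner.
    by apply: ex_derive; exact: is_derive_gegen_powR.
  + rewrite sqrrN expr1n subrr powR0 ?mul0r; last by have := nu_gt0; lra.
    rewrite -(mul0r p.[-1]); apply: cvgM; last exact/cvg_at_right_filter/cp.
    apply: edge.
      by near=> x; rewrite in_itv/=; apply/andP; split; near: x;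
        [exact: nbhs_right_gt|apply: nbhs_right_lt; lra].
    by rewrite -[X in _ --> X](arg_edge _ (sqrrN 1)); exact/cvg_at_right_filter/arg_continuous.
  + rewrite expr1n subrr powR0 ?mul0r; last by have := nu_gt0; lra.
    rewrite -(mul0r p.[1]); apply: cvgM; last exact/cvg_at_left_filter/cp.
    apply: edge.
      by near=> x; rewrite in_itv/=; apply/andP; split; near: x;
        [apply: nbhs_left_gt; lra|exact: nbhs_left_lt].
    by rewrite -[X in _ --> X](arg_edge _ erefl); exact/cvg_at_left_filter/arg_continuous.
Unshelve. all: by end_near. Qed.

(** With p the derivative of the Gegenbauer polynomial, [gegen_int_deriv] and the differential
    equation show that a nonzero eigenvalue times this integral is 0. *)
Lemma gegen_int_gegen_poly n : gegen_int (gegen_poly nu n.+1) = 0.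
Proof.
have := gegen_int_deriv (gegen_poly nu n.+1)^`().
rewrite gegen_poly_ode// gegen_intZ => /eqP; rewrite mulf_eq0 => /orP[|/eqP//].
rewrite oppr_eq0 mulf_eq0 pnatr_eq0 /= => /eqP n0.
have : 0 <= n.+1%:R :> R by [].
by have := nu_gt0; lra.
Qed.

(** Induction on k: the recurrence trades one factor x for the indices n + 1 and n - 1, both above
    the smaller exponent. *)
Lemma gegen_int_mulXn n k :
  (k < n)%N -> gegen_int ('X^k * gegen_poly nu n) = 0.
Proof.
elim: k n => [|k IHk] [|n]// kn; first by rewrite mul1r gegen_int_gegen_poly.
rewrite exprSr -mulrA gegen_poly_rec// mulrDr -!scalerAr gegen_intD !gegen_intZ.
by rewrite !IHk ?mulr0 ?addr0//; lia.
Qed.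

Lemma gegen_int_mul_eq0 n q :
  (size q <= n)%N -> gegen_int (q * gegen_poly nu n) = 0.
Proof.
move=> qn; rewrite -[q]coefK poly_def mulr_suml.
pose P p := gegen_int p = 0; apply: (big_ind P).
- by rewrite /P -[0](scale0r 0) gegen_intZ mul0r.
- by move=> p p' hp hp'; rewrite /P gegen_intD hp hp' addr0.
move=> k _; rewrite /P -scalerAl gegen_intZ gegen_int_mulXn ?mulr0//.
exact: leq_trans (ltn_ord k) qn.
Qed.

End GegenbauerIntegral.

(** * Complex-valued integrals against the Gegenbauer weight *)

Section ComplexIntegral.
Variables (R : realType) (nu : R).
Hypothesis nu_gt0 : 0 < nu.
Local Notation C := R[i].
Implicit Types (h : {poly C}) (q : {poly R}).
Local Notation Rep := (map_poly (@complex.Re R)).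
Local Notation Imp := (map_poly (@complex.Im R)).
Local Notation toC := (map_poly (real_complex R)).

Definition gegen_intC h : C := gegen_int nu (Rep h) +i* gegen_int nu (Imp h).

Let coef_Re h k : (Rep h)`_k = complex.Re h`_k.
Proof. exact: coef_map_id0. Qed.

Let coef_Im h k : (Imp h)`_k = complex.Im h`_k.
Proof. exact: coef_map_id0. Qed.

Lemma gegen_intCD h h' : gegen_intC (h + h') = gegen_intC h + gegen_intC h'.
Proof.
rewrite /gegen_intC.
have -> : Rep (h + h') = Rep h + Rep h'.
  apply/polyP => k; rewrite coefD !coef_Re coefD.
  by case: (h`_k); case: (h'`_k).
have -> : Imp (h + h') = Imp h + Imp h'.
  apply/polyP => k; rewrite coefD !coef_Im coefD.
  by case: (h`_k); case: (h'`_k).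
by rewrite !gegen_intD.
Qed.

Lemma gegen_intCZ (c : C) h : gegen_intC (c *: h) = c * gegen_intC h.
Proof.
case: c => a b; rewrite /gegen_intC.
have -> : Rep ((a +i* b) *: h) = a *: Rep h + (- b) *: Imp h.
  apply/polyP => k; rewrite coefD !coefZ !coef_Re coef_Im coefZ.
  by case: (h`_k) => x y /=; rewrite mulNr.
have -> : Imp ((a +i* b) *: h) = a *: Imp h + b *: Rep h.
  apply/polyP => k; rewrite coefD !coefZ !coef_Im coef_Re coefZ.
  by case: (h`_k).
by rewrite !gegen_intD// !gegen_intZ// mulNr.
Qed.

Lemma gegen_intC0 : gegen_intC 0 = 0.
Proof.
rewrite /gegen_intC /map_poly !size_poly0 !poly_def !big_ord0.
by rewrite -[0](scale0r 0) gegen_intZ// mul0r.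
Qed.

Lemma gegen_intC_sum (I : finType) (h : I -> {poly C}) :
  gegen_intC (\sum_i h i) = \sum_i gegen_intC (h i).
Proof. exact: (big_morph gegen_intC gegen_intCD gegen_intC0). Qed.

(** The Gegenbauer polynomial is real, so it multiplies the real and imaginary parts of h
    separately. *)
Lemma gegen_intC_mul_eq0 n h : (size h <= n)%N ->
  gegen_intC (h * toC (gegen_poly nu n)) = 0.
Proof.
move=> hn; rewrite /gegen_intC.
have -> : Rep (h * toC (gegen_poly nu n)) = Rep h * gegen_poly nu n.
  apply/polyP => k; rewrite coef_Re !coefM raddf_sum.
  apply: eq_bigr => i _; rewrite coef_Re coef_map.
  by case: (h`_i) => a b /=; rewrite mulr0 subr0.
have -> : Imp (h * toC (gegen_poly nu n)) = Imp h * gegen_poly nu n.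
  apply/polyP => k; rewrite coef_Im !coefM raddf_sum.
  apply: eq_bigr => i _; rewrite coef_Im coef_map.
  by case: (h`_i) => a b /=; rewrite mulr0 add0r.
by rewrite !gegen_int_mul_eq0//; exact: leq_trans (size_poly _ _) hn.
Qed.

Lemma complex_integral_gegen h :
  complex_integral `]-1, 1[%classic
    (fun x : R => (gegen_weight nu x)%:C * h.[x%:C]) = gegen_intC h.
Proof.
have ReE (x : R) : complex.Re h.[x%:C] = (Rep h).[x].
  rewrite horner_coef raddf_sum (horner_coef_wide x (size_poly _ _)).
  apply: eq_bigr => i _; rewrite coef_Re -rmorphXn.
  by case: (h`_i) => a b /=; rewrite mulr0 subr0.
have ImE (x : R) : complex.Im h.[x%:C] = (Imp h).[x].
  rewrite horner_coef raddf_sum (horner_coef_wide x (size_poly _ _)).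
  apply: eq_bigr => i _; rewrite coef_Im -rmorphXn.
  by case: (h`_i) => a b /=; rewrite mulr0 add0r.
rewrite /complex_integral /gegen_intC /gegen_int.
congr (_ +i* _); apply: eq_Rintegral => x _.
  by rewrite -ReE; case: (h.[_]) => a b /=; rewrite mul0r subr0.
by rewrite -ImE; case: (h.[_]) => a b /=; rewrite mul0r addr0.
Qed.

End ComplexIntegral.

(** * Matrix polynomials read as matrices of polynomials *)

Section MatrixPolynomialEntries.
Variables (C : fieldType) (m : nat).
Local Notation Mat := 'M[C]_m.+1.
Implicit Types (P Q : {poly Mat}) (A : Mat) (i j k : 'I_m.+1).

Definition mxpoly_entry P i j : {poly C} := map_poly (fun A : Mat => A i j) P.

Lemma coef_mxpoly_entry P i j l : (mxpoly_entry P i j)`_l = P`_l i j.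
Proof. by rewrite /mxpoly_entry coef_map_id0 ?mxE. Qed.

Lemma mxpoly_entryD P Q i j :
  mxpoly_entry (P + Q) i j = mxpoly_entry P i j + mxpoly_entry Q i j.
Proof. by apply/polyP => l; rewrite !(coefD, coef_mxpoly_entry) mxE. Qed.

Lemma mxpoly_entryN P i j : mxpoly_entry (- P) i j = - mxpoly_entry P i j.
Proof. by apply/polyP => l; rewrite !(coefN, coef_mxpoly_entry) mxE. Qed.

Lemma mxpoly_entryMX P i j : mxpoly_entry ('X * P) i j = 'X * mxpoly_entry P i j.
Proof.
apply/polyP => l; rewrite !(coefXM, coef_mxpoly_entry).
by case: eqP => //; rewrite mxE.
Qed.

Lemma mxpoly_entryCM A P i j :
  mxpoly_entry (A%:P * P) i j = \sum_k A i k *: mxpoly_entry P k j.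
Proof.
apply/polyP => l; rewrite coef_mxpoly_entry coefCM mxE coef_sum.
by apply: eq_bigr => k _; rewrite coefZ coef_mxpoly_entry.
Qed.

Lemma mxpoly_entryC A i j : mxpoly_entry A%:P i j = (A i j)%:P.
Proof.
apply/polyP => l; rewrite coef_mxpoly_entry !coefC.
by case: eqP; rewrite ?mxE.
Qed.

Lemma size_mxpoly_entry P i j : (size (mxpoly_entry P i j) <= size P)%N.
Proof. exact: size_poly. Qed.

Lemma horner_mxpoly_entry P (x : C) i j :
  (mxpoly_entry P i j).[x] = P.[x%:M] i j.
Proof.
rewrite (horner_coef_wide _ (size_mxpoly_entry P i j)) horner_coef summxE.
apply: eq_bigr => l _; rewrite coef_mxpoly_entry -rmorphXn /=.
by rewrite -[_ * _%:M]/(_ *m _) mul_mx_scalar mxE mulrC.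
Qed.

End MatrixPolynomialEntries.

(** * Expansion of the weight matrix *)

Section WeightExpansion.
Variables (R : realType) (L : nat) (nu : R).
Hypothesis nu_gt0 : 0 < nu.
Local Notation G := (pochhammer nu).
Local Notation phi := (phi L nu).
Implicit Types (n t i k m : nat).

(** Reversal of the factors. With the next lemma it turns the Pochhammer symbols of the weight at
    negative arguments into signs, factorials and symbols at nu. *)
Lemma pochhammerN_nat (j c : nat) :
  pochhammer (- (j + c)%:R : R) j * c`!%:R = (-1) ^+ j * (j + c)`!%:R.
Proof.
elim: j => [|j IHj]; first by rewrite pochhammer0 !mul1r.
rewrite pochhammerSl addSn -natr1 opprD subrK -mulrA IHj factS natrM exprS -natr1.
by ring.
Qed.

Lemma pochhammerN_shift t r :
  pochhammer (- (t + r)%:R - nu) t * G r.+1 = (-1) ^+ t * G (t + r).+1.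
Proof.
elim: t => [|t IHt]; first by rewrite pochhammer0 !mul1r.
rewrite pochhammerSl addSn.
have -> : - (t + r).+1%:R - nu + 1 = - (t + r)%:R - nu :> R.
  by rewrite -natr1; ring.
rewrite -mulrA IHt [in RHS]pochhammerS exprS -natr1.
by ring.
Qed.

(** For n = 0 the Pochhammer quotient in [phi_outer] is 1 and the rest is symmetric. This matches
    the reflection that defines the lower half of the weight. *)
Lemma phi0_sym t i k : (i <= L)%N -> (k <= L)%N -> phi 0 t i k = phi 0 t k i.
Proof.
move=> iL kL; rewrite /phi andbCA [(k + i)%N]addnC; case: ifP => // _.
have outer_sym : phi_outer L nu 0 i (L - i) k = phi_outer L nu 0 k (L - k) i.
  rewrite /phi_outer !add0n !divff ?mulf_neq0 ?pochhammer_neq0//.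
  congr (_%:R / _ / _ * _ * _); rewrite (mulnC i`!) -!mulnA.
  by rewrite (mulnC (L - i)`!).
have inner_sym a b c : phi_inner nu 0 t a b c = phi_inner nu 0 t b a c.
  rewrite /phi_inner !add0n (addnC a) [G a * _]mulrC; congr (_ / _).
  by rewrite (mulnAC t`!).
by rewrite outer_sym inner_sym.
Qed.

(** The factor (2 nu)_d / d! is the one that [gegenbauerE] splits off; the signs (-1)^m, (-1)^(m -
    t) and (-1)^t cancel. *)
Lemma weight_coefE m n t : (m <= n)%N -> (n <= L)%N ->
  (n + m - L <= t)%N -> (t <= m)%N ->
  weight_coef L nu m n t *
    (pochhammer (2 * nu) (m + n - 2 * t) / (m + n - 2 * t)`!%:R) = phi 0 t m n.
Proof.
move=> mn nL Lt tm.
pose a := (m - t)%N; pose b := (n - t)%N; pose c := (L + t - (m + n))%N.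
have ma : m = (t + a)%N by rewrite /a; lia.
have nb : n = (t + b)%N by rewrite /b; lia.
have Lc : L = (t + a + b + c)%N by rewrite /a /b /c; lia.
rewrite (@phiE R L nu 0 t m n a b c) //; last by lia.
rewrite /weight_coef -/a -/b.
have -> : (m + n - 2 * t = a + b)%N by lia.
have -> : (n + m - 2 * t = a + b)%N by lia.
have -> : (n + m - t = a + b + t)%N by lia.
have -> : n%:R - L%:R = - (a + c)%:R :> R by rewrite Lc nb !natrD; ring.
have -> : pochhammer (- (a + c)%:R : R) a = (-1) ^+ a * (a + c)`!%:R / c`!%:R.
  by rewrite -pochhammerN_nat mulfK// pnatr_eq0 -lt0n fact_gt0.
have Ltr : L = (t + (a + b + c))%N by lia.
have -> : pochhammer (- L%:R - nu) t = (-1) ^+ t * G L.+1 / G (a + b + c).+1.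
  by rewrite {1 2}Ltr -pochhammerN_shift mulfK// pochhammer_neq0.
have -> : (-1) ^+ m = (-1) ^+ a * (-1) ^+ t :> R by rewrite ma exprD mulrC.
have s1 k : (-1) ^+ k * (-1) ^+ k = 1 :> R by rewrite -expr2 sqrr_sign.
rewrite /phi_outer /phi_inner !add0n pochhammer0 !pochhammerS !natrM expr0.
have -> : (L - n = a + c)%N by lia.
move: (s1 a) (s1 t); move: ((-1) ^+ a) ((-1) ^+ t) => sa st e1 e2.
have nu0 := nu_gt0; have abt0 : 0 <= (a + b + t)%:R :> R by [].
have abc0 : 0 <= (a + b + c)%:R :> R by [].
have f0 k : k`!%:R != 0 :> R by rewrite pnatr_eq0 -lt0n fact_gt0.
have p0 k : G k != 0 by exact: pochhammer_neq0.
have p1 k : pochhammer (2 * nu) k != 0 by rewrite pochhammer_neq0// mulr_gt0.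
rewrite !addn0.
move: (a + b + t)%N (a + b + c)%N abt0 abc0 => x y x0 y0.
field: e1 e2; repeat (apply/andP; split);
  first [apply: f0 | apply: p0 | apply: p1 | apply: lt0r_neq0; lra].
Qed.

(** The expected entries of P_n W / w. All Gegenbauer indices are at least n, whence the
    orthogonality to lower degrees. *)
Definition Phi n i k : {poly R} :=
  \sum_(t < L.+1) phi n t i k *: gegen_poly nu (i + k - t.*2 + n).

Let weight_entryE m n x : (m <= n)%N -> (n <= L)%N ->
  weight_entry L nu m n x = gegen_weight nu x * (Phi 0 m n).[x].
Proof.
move=> mn nL; congr (_ * _); rewrite /Phi horner_sum.
pose F t := phi 0 t m n * (gegen_poly nu (m + n - t.*2)).[x].
rewrite (eq_bigr (fun t : 'I_L.+1 => F t)); last first.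
  by move=> t _; rewrite hornerZ addn0.
rewrite -(big_mkord xpredT F) [in RHS](big_cat_nat (n := (n + m - L)%N))//=; last by lia.
rewrite [X in _ = X + _]big_nat_cond [X in _ = X + _]big1 ?add0r; last first.
  by move=> t /andP[/andP[_ h] _]; rewrite /F phi_eq0 ?mul0r//; lia.
rewrite [in RHS](big_cat_nat (n := m.+1))//=; [|lia|lia].
rewrite [X in _ = _ + X]big_nat_cond [X in _ = _ + X]big1 ?addr0; last first.
  by move=> t /andP[/andP[h _] _]; rewrite /F phi_eq0 ?mul0r//; lia.
apply: eq_big_nat => t /andP[h1 h2].
rewrite gegenbauerE// mulrA (weight_coefE mn nL)//.
by rewrite /F -mul2n.
Qed.

Lemma weightE x (i k : 'I_L.+1) :
  weight L nu x i k = gegen_weight nu x * (Phi 0 i k).[x].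
Proof.
rewrite mxE; have iL : (i <= L)%N := ltn_ord i; have kL : (k <= L)%N := ltn_ord k.
case: leqP => ik; rewrite weight_entryE//; last exact: ltnW.
rewrite /Phi; congr (_ * _.[_]).
by apply: eq_bigr => t _; rewrite phi0_sym// [(k + i)%N]addnC.
Qed.

(** Contributions at t = s and at t = s - 1 are brought to the common range s < L + 2; the added
    terms are 0. *)
Let sum_phi n i k (f : nat -> {poly R}) : (k <= L)%N ->
  \sum_(t < L.+1) phi n t i k *: f t = \sum_(s < L.+2) phi n s i k *: f s.
Proof.
by move=> kL; rewrite [RHS]big_ord_recr /= phi_eq0 ?scale0r ?addr0//; lia.
Qed.

Let sum_phi_pred n i k (f : nat -> {poly R}) :
  \sum_(t < L.+1) phi n t i k *: f t.+1 =
  \sum_(s < L.+2) phi_pred L nu n s i k *: f s.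
Proof. by rewrite [RHS]big_ord_recl /= scale0r add0r. Qed.

Lemma Phi_rec n (i k : nat) : (i <= L)%N -> (k <= L)%N ->
  'X * Phi n i k = Phi n.+1 i k +
  (if i is i'.+1 then recB_sub nu n i *: Phi n i' k else 0) +
  (if (i < L)%N then recB_sub nu n (L - i) *: Phi n i.+1 k else 0) +
  (if n is n'.+1 then recC_diag L nu n i *: Phi n' i k else 0).
Proof.
move=> iL kL; pose e s := gegen_poly nu (i + k + n + 1 - s.*2).
pose d s := (i + k - s.*2 + n)%N; pose d' s := (i + k + 2 - s.*2 + n)%N.
(* Truncated subtraction distorts an index only where the coefficient is 0. *)
have phiZ m t j (c : R) (p q : {poly R}) : (t <= j -> t <= k -> p = q)%N ->
    (phi m t j k * c) *: p = (phi m t j k * c) *: q.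
  move=> pq; case: (leqP t j) => tj; last by rewrite phi_eq0 ?mul0r ?scale0r ?tj.
  case: (leqP t k) => tk; last by rewrite phi_eq0 ?mul0r ?scale0r ?tk ?orbT.
  by rewrite pq.
pose u s : R := ((d s)%:R + 2 * nu) / (2 * ((d s)%:R + nu)).
pose v s : R := (d' s)%:R / (2 * ((d' s)%:R + nu)).
have XPhi : 'X * Phi n i k = \sum_(s < L.+2)
    (phi n s i k * u s + phi_pred L nu n s i k * v s) *: e s.
  rewrite /Phi mulr_sumr.
  under [RHS]eq_bigr do rewrite scalerDl -2!scalerA.
  rewrite [RHS]big_split /= -(@sum_phi n i k (fun s => u s *: e s) kL).
  rewrite -(@sum_phi_pred n i k (fun s => v s *: e s)) -big_split /=.
  apply: eq_bigr => t _; rewrite -scalerAr gegen_poly_rec// scalerDr !scalerA.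
  congr (_ + _).
    by apply: phiZ => *; congr gegen_poly; lia.
  rewrite /v (_ : d' t.+1 = (i + k - t.*2 + n)%N) /d'; last by lia.
  by apply: phiZ => *; congr gegen_poly; lia.
have phiZ1 m t j (p q : {poly R}) : (t <= j -> t <= k -> p = q)%N ->
    phi m t j k *: p = phi m t j k *: q.
  by move=> pq; rewrite -[phi _ _ _ _]mulr1; apply: phiZ.
have Phi_next : Phi n.+1 i k = \sum_(s < L.+2) phi n.+1 s i k *: e s.
  rewrite -sum_phi//; apply: eq_bigr => t _; apply: phiZ1 => *.
  by congr gegen_poly; lia.
have Phi_succ : Phi n i.+1 k = \sum_(s < L.+2) phi n s i.+1 k *: e s.
  rewrite -sum_phi//; apply: eq_bigr => t _; apply: phiZ1 => *.
  by congr gegen_poly; lia.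
have Phi_prev n' : n = n'.+1 ->
    Phi n' i k = \sum_(s < L.+2) phi_pred L nu n' s i k *: e s.
  move=> nE; rewrite -sum_phi_pred; apply: eq_bigr => t _; apply: phiZ1 => *.
  by congr gegen_poly; lia.
have Phi_pred i' : i = i'.+1 ->
    Phi n i' k = \sum_(s < L.+2) phi_pred L nu n s i' k *: e s.
  move=> iE; rewrite -sum_phi_pred; apply: eq_bigr => t _; apply: phiZ1 => *.
  by congr gegen_poly; lia.
rewrite XPhi Phi_next Phi_succ.
under eq_bigr do rewrite phi_rec// !scalerDl.
rewrite !big_split /=; congr (_ + _ + _ + _).
- case: (i) Phi_pred => [|i'] Phi_pred; first by rewrite big1// => *; rewrite scale0r.
  rewrite Phi_pred// scaler_sumr.
  by apply: eq_bigr => t _; rewrite scalerA.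
- case: ifP => _; last by rewrite big1// => *; rewrite scale0r.
  by rewrite scaler_sumr; apply: eq_bigr => t _; rewrite scalerA.
- case: (n) Phi_prev => [|n'] Phi_prev; first by rewrite big1// => *; rewrite scale0r.
  rewrite Phi_prev// scaler_sumr.
  by apply: eq_bigr => t _; rewrite scalerA.
Qed.

End WeightExpansion.

(** * Orthogonality and the recurrence *)

Section Orthogonality.
Local Open Scope sesquilinear_scope.
Variables (R : realType) (L : nat) (nu : R).
Hypothesis nu_gt0 : 0 < nu.
Local Notation C := R[i].
Local Notation Mat := 'M[C]_L.+1.
Local Notation toC := (map_poly (real_complex R)).
Local Notation Phi := (Phi L nu).
Local Notation ip := (mxpoly_ip (weight L nu)).
Implicit Types (P Q T D : {poly Mat}) (A H : Mat) (i j k : 'I_L.+1) (n : nat).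

(* [Phi 0] is the weight matrix without its scalar factor, so this is an entry of
   the polynomial matrix P W / (1 - x^2)^(nu - 1/2). *)
Definition mul_Phi P i k : {poly C} :=
  \sum_j mxpoly_entry P i j * toC (Phi 0 j k).

Lemma mul_PhiD P Q i k : mul_Phi (P + Q) i k = mul_Phi P i k + mul_Phi Q i k.
Proof.
rewrite /mul_Phi -big_split; apply: eq_bigr => j _.
by rewrite mxpoly_entryD mulrDl.
Qed.

Lemma mul_PhiN P i k : mul_Phi (- P) i k = - mul_Phi P i k.
Proof.
rewrite /mul_Phi -sumrN; apply: eq_bigr => j _.
by rewrite mxpoly_entryN mulNr.
Qed.

Lemma mul_PhiMX P i k : mul_Phi ('X * P) i k = 'X * mul_Phi P i k.
Proof.
rewrite /mul_Phi mulr_sumr; apply: eq_bigr => j _.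
by rewrite mxpoly_entryMX mulrA.
Qed.

Lemma mul_PhiCM A P i k :
  mul_Phi (A%:P * P) i k = \sum_j A i j *: mul_Phi P j k.
Proof.
rewrite /mul_Phi.
under eq_bigr do rewrite mxpoly_entryCM mulr_suml.
rewrite exchange_big; apply: eq_bigr => j _.
by rewrite scaler_sumr; apply: eq_bigr => l _; rewrite scalerAl.
Qed.

Lemma mul_Phi1 i k : mul_Phi 1 i k = toC (Phi 0 i k).
Proof.
rewrite /mul_Phi (bigD1 i)//= big1 ?addr0 => [|j ji]; rewrite mxpoly_entryC mxE.
  by rewrite eqxx mul1r.
by rewrite eq_sym (negbTE ji) mul0r.
Qed.

(** The weight matrix is w times [Phi 0], and at real x conjugation affects only the coefficients of
    Q. *)
Lemma mxpoly_ipE P Q : ip P Q = \matrix_(i, j) gegen_intC nu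
  (\sum_a mul_Phi P i a * map_poly Num.conj (mxpoly_entry Q j a)).
Proof.
apply/matrixP => i j; rewrite [RHS]mxE mxE -complex_integral_gegen; congr complex_integral.
apply/funext => x; rewrite mxE horner_sum mulr_sumr.
apply: eq_bigr => a _; rewrite hornerM mulrA; congr (_ * _).
  rewrite mxE /mul_Phi horner_sum mulr_sumr; apply: eq_bigr => b _.
  rewrite hornerM horner_mxpoly_entry mxE weightE// rmorphM /= horner_map.
  by rewrite mulrCA.
rewrite !mxE -horner_mxpoly_entry.
have conjx : Num.conj x%:C = x%:C by exact: conjc_real.
by rewrite -[in RHS]conjx; apply/esym; exact: horner_map.
Qed.

Lemma mxpoly_ipD P P' Q : ip (P + P') Q = ip P Q + ip P' Q.
Proof.
rewrite !mxpoly_ipE; apply/matrixP => i j; rewrite !mxE -gegen_intCD// -big_split.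
by congr gegen_intC; apply: eq_bigr => a _; rewrite mul_PhiD mulrDl.
Qed.

Lemma mxpoly_ipCM A P Q : ip (A%:P * P) Q = A *m ip P Q.
Proof.
rewrite !mxpoly_ipE; apply/matrixP => i j; rewrite !mxE.
under [RHS]eq_bigr do rewrite mxE -gegen_intCZ//.
rewrite -gegen_intC_sum//; congr gegen_intC.
under [LHS]eq_bigr do rewrite mul_PhiCM mulr_suml.
rewrite exchange_big; apply: eq_bigr => b _; rewrite scaler_sumr.
by apply: eq_bigr => a _; rewrite scalerAl.
Qed.

Lemma gegen_intC_Phi_mul n (i k : nat) (h : {poly C}) : (size h <= n)%N ->
  gegen_intC nu (toC (Phi n i k) * h) = 0.
Proof.
move=> hn; rewrite /Phi rmorph_sum mulr_suml gegen_intC_sum// big1// => t _.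
rewrite /= map_polyZ -scalerAl scalerAr mulrC.
apply: gegen_intC_mul_eq0 => //.
by rewrite (leq_trans (size_scale_leq _ _))// (leq_trans hn)// leq_addl.
Qed.

Lemma mxpoly_ip_Phi_eq0 n T Q :
  (forall i k, mul_Phi T i k = toC (Phi n i k)) -> (size Q <= n)%N ->
  ip T Q = 0.
Proof.
move=> TPhi Qn; rewrite mxpoly_ipE; apply/matrixP => i j; rewrite !mxE.
rewrite gegen_intC_sum// big1// => a _; rewrite TPhi gegen_intC_Phi_mul//.
by rewrite (leq_trans (size_poly _ _))// (leq_trans (size_mxpoly_entry _ _ _)).
Qed.

Lemma sum_delta_mx (M : lmodType R) (a b : nat) (i : 'I_L.+1) (F : nat -> M) :
  (a <= L)%N -> (b <= L)%N ->
  \sum_(j < L.+1) Emx R L a b i j *: F j = (i == a :> nat)%:R *: F b.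
Proof.
move=> aL bL; rewrite (bigD1 (inord b)) //= big1 ?addr0 => [|j jb].
  rewrite mxE eqxx andbT inordK//; congr (_%:R *: _).
  by rewrite -(inj_eq val_inj) /= inordK.
by rewrite mxE (negbTE jb) andbF scale0r.
Qed.

Lemma sum_recB n (i : 'I_L.+1) (F : nat -> {poly R}) :
  \sum_(j < L.+1) recB L nu n i j *: toC (F j) =
  toC ((if val i is i'.+1 then recB_sub nu n i *: F i' else 0) +
       (if (i < L)%N then recB_sub nu n (L - i) *: F i.+1 else 0)).
Proof.
rewrite /recB; set B1 : 'M[R]_L.+1 := \sum_(1 <= j < _) _.
set B2 : 'M[R]_L.+1 := \sum_(0 <= j < L) _.
under eq_bigr do rewrite mxE -map_polyZ.
rewrite -rmorph_sum; congr (toC _).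
under eq_bigr do rewrite mxE scalerDl.
rewrite big_split; congr (_ + _).
  rewrite /B1 big_add1 /=.
  under eq_bigr do rewrite summxE scaler_suml.
  rewrite exchange_big /= big_mkord.
  under eq_bigr => l _.
    under eq_bigr do rewrite mxE -scalerA.
    rewrite -scaler_sumr sum_delta_mx; [|exact: (ltn_ord l)|exact: ltnW (ltn_ord l)].
    over.
  case: i => -[|i'] /= iL; first by rewrite big1// => l _; rewrite scale0r scaler0.
  rewrite (bigD1 (Ordinal (iL : (i' < L)%N)))//= eqxx scale1r big1 ?addr0// => l li.
  by move: li; rewrite -(inj_eq val_inj) eqSS eq_sym /= => /negbTE->; rewrite scale0r scaler0.
rewrite /B2.
under eq_bigr do rewrite summxE scaler_suml.
rewrite exchange_big /= big_mkord.
under eq_bigr => l _.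
  under eq_bigr do rewrite mxE -scalerA.
  rewrite -scaler_sumr sum_delta_mx; [|exact: ltnW (ltn_ord l)|exact: ltn_ord l].
  over.
case: ifP => iL; last first.
  rewrite big1// => l _; rewrite (_ : (_ == _) = false) ?scale0r ?scaler0//.
  by apply/negbTE; apply: contraFN iL => /eqP ->.
rewrite (bigD1 (Ordinal iL))//= eqxx scale1r big1 ?addr0 => [|l li].
  by rewrite /recB_sub natrB ?(ltnW iL)//; congr (_ / (_ * _) *: _); ring.
by move: li; rewrite -(inj_eq val_inj) eq_sym /= => /negbTE->; rewrite scale0r scaler0.
Qed.

Lemma sum_recC n (i : 'I_L.+1) (F : nat -> {poly R}) :
  \sum_(j < L.+1) recC L nu n i j *: toC (F j) = toC (recC_diag L nu n i *: F i).
Proof.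
rewrite /recC; set B1 : 'M[R]_L.+1 := \sum_(0 <= j < _) _.
under eq_bigr do rewrite mxE -map_polyZ.
rewrite -rmorph_sum; congr (toC _); rewrite /B1.
under eq_bigr do rewrite summxE scaler_suml.
rewrite exchange_big /= big_mkord.
under eq_bigr => l _.
  under eq_bigr do rewrite mxE -scalerA.
  rewrite -scaler_sumr sum_delta_mx; [|exact: (ltn_ord l)|exact: (ltn_ord l)].
  over.
rewrite (bigD1 i)//= eqxx scale1r big1 ?addr0// => l li.
by move: li; rewrite -(inj_eq val_inj) eq_sym /= => /negbTE->; rewrite scale0r scaler0.
Qed.

(** P' stands for P_(n-1); for n = 0 it is arbitrary and the last term is 0. *)
Lemma mul_Phi_rec n (P P' : {poly Mat}) :
  (forall i k, mul_Phi P i k = toC (Phi n i k)) ->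
  (forall n', n = n'.+1 -> forall i k, mul_Phi P' i k = toC (Phi n' i k)) ->
  forall i k, mul_Phi ('X * P - (recB L nu n)%:P * P -
    (if n is _.+1 then (recC L nu n)%:P * P' else 0)) i k = toC (Phi n.+1 i k).
Proof.
move=> hP hP' i k; rewrite !(mul_PhiD, mul_PhiN) mul_PhiMX mul_PhiCM hP.
under eq_bigr do rewrite hP.
rewrite (sum_recB n i (fun j : nat => Phi n j k)).
have -> : mul_Phi (if n is _.+1 then (recC L nu n)%:P * P' else 0) i k =
    toC (if n is n'.+1 then recC_diag L nu n i *: Phi n' i k else 0).
  case: n hP hP' => [|n] hP hP'.
    by rewrite rmorph0 /mul_Phi big1// => j _; rewrite /mxpoly_entry map_poly0 mul0r.
  rewrite mul_PhiCM; under eq_bigr do rewrite (hP' n)//.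
  exact: (sum_recC n.+1 i (fun j : nat => Phi n j k)).
rewrite -[X in X * _](map_polyX (real_complex R)) -!rmorphM -!rmorphB; congr (toC _).
rewrite Phi_rec//; [|exact: (ltn_ord i)|exact: (ltn_ord k)].
by rewrite addrAC addrK -[X in X - _]addrA addrK.
Qed.

(** A nonzero row v of A would give v H v* = 0, against positivity. *)
Lemma posdefmx_mul_eq0 A H : posdefmx H -> A *m H = 0 -> A = 0.
Proof.
move=> [_ Hpos] AH; apply/row_matrixP => i; rewrite row0; apply/eqP.
apply: contraT => /Hpos; rewrite -row_mul AH row0 mul0mx mxE ltxx.
by [].
Qed.

(** Induction on the degree bound: subtracting D_n P_n, with D_n the top coefficient, lowers it, so
    D = D_n P_n; pairing with P_n gives D_n H_n = 0. *)
Lemma mxpoly_ip_nondegenerate (P : nat -> {poly Mat}) :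
  monic_mvop (weight L nu) P -> forall n D, (size D <= n)%N ->
  (forall j : nat, (j < n)%N -> ip D (P j) = 0) -> D = 0.
Proof.
move=> [Pmonic [H [Hpos HP]]]; elim=> [|n IHn] D Dn Dorth.
  by apply/eqP; rewrite -size_poly_leq0.
have [/monicP Pnn sPn] := Pmonic n; rewrite lead_coefE sPn /= in Pnn.
have DE : D - (D`_n)%:P * P n = 0.
  apply: IHn => [|j jn].
    apply/leq_sizeP => j nj; rewrite coefB coefCM.
    have [<-|nj'] := eqVneq n j.
      by rewrite Pnn mulr1 subrr.
    have jn : (n < j)%N by rewrite ltn_neqAle nj' nj.
    rewrite [D`_j]nth_default; last exact: leq_trans Dn jn.
    by rewrite [(P n)`_j]nth_default ?sPn// mulr0 subr0.
  rewrite -mulNr -polyCN mxpoly_ipD mxpoly_ipCM (HP n j) (Dorth j (leqW jn)).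
  by rewrite gtn_eqF// scale0r mulmx0 addr0.
have /posdefmx_mul_eq0 -/(_ (D`_n)) Dn0 := Hpos n.
move/eqP: DE; rewrite subr_eq0 => /eqP DE.
rewrite DE Dn0 ?polyC0 ?mul0r//.
apply: etrans (Dorth n (ltnSn n)); rewrite [in RHS]DE.
by rewrite mxpoly_ipCM HP eqxx scale1r.
Qed.

Lemma monic_mvop_recurrence n (P : nat -> {poly Mat}) : monic_mvop (weight L nu) P ->
    'X * P n = P n.+1 + (recB L nu n)%:P * P n
               + (if n is k.+1 then (recC L nu n)%:P * P k else 0).
Proof.
move=> mP; have [Pmonic [H [_ HP]]] := mP.
have Pnn m : (P m)`_m = 1.
  by have [/monicP] := Pmonic m; rewrite lead_coefE => + sPm; rewrite sPm.
have P_eq0 m l : (m < l)%N -> (P m)`_l = 0.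
  by move=> ml; rewrite nth_default// (Pmonic m).2.
pose low m : {poly Mat} := if m is k.+1 then (recC L nu m)%:P * P k else 0.
pose T m := 'X * P m - (recB L nu m)%:P * P m - low m.
have low_eq0 m l : (m < l)%N -> (low m)`_l = 0.
  by case: m => [|m] ml; rewrite ?coef0// coefCM P_eq0 ?mulr0// ltnW.
have step m : (forall i k, mul_Phi (T m) i k = toC (Phi m.+1 i k)) ->
    T m = P m.+1.
  move=> hT; apply/eqP; rewrite -subr_eq0; apply/eqP.
  apply: (mxpoly_ip_nondegenerate mP (n := m.+1)) => [|j jm]; last first.
    rewrite mxpoly_ipD (mxpoly_ip_Phi_eq0 hT) ?(Pmonic j).2// add0r.
    have -> : - P m.+1 = (- 1)%:P * P m.+1 by rewrite polyCN mulN1r.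
    by rewrite mxpoly_ipCM HP gtn_eqF// scale0r mulmx0.
  (* The coefficients of X^(m+1) are both 1 and cancel. *)
  apply/leq_sizeP => j mj; rewrite /T !coefB coefXM coefCM (P_eq0 m j)// mulr0 low_eq0//.
  case: j mj => // j; rewrite ltnS leq_eqVlt /= !subr0 => /predU1P[<-|mj].
    by rewrite !Pnn subrr.
  by rewrite !P_eq0 ?subrr.
pose P_Phi m := forall i k, mul_Phi (P m) i k = toC (Phi m i k).
have T_Phi m : (forall l : nat, (l <= m)%N -> P_Phi l) ->
    forall i k, mul_Phi (T m) i k = toC (Phi m.+1 i k).
  case: m => [|m] hP.
    by apply: (@mul_Phi_rec 0 (P 0) 0) => //; exact: hP.
  apply: (@mul_Phi_rec m.+1 (P m.+1) (P m)); first exact: hP.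
  by move=> _ [<-]; apply: hP.
(* Strong induction: the expansions up to P_m give that of T = P_(m+1), starting from P_0 = 1. *)
have all_P_Phi m : P_Phi m.
  elim/ltn_ind: m => -[|m] IHm i k; last by rewrite -step; exact: T_Phi.
  by rewrite [P 0]size1_polyC ?Pnn ?(Pmonic 0).2// mul_Phi1.
rewrite -step; last exact: T_Phi.
by rewrite /T addrAC !subrK.
Qed.

End Orthogonality.

Theorem theorem3p3 (R : realType) (L : nat) (nu : R)
  (P : nat -> {poly 'M[R[i]]_L.+1}) :
  0 < nu -> monic_mvop (weight L nu) P ->
  forall n : nat,
    'X * P n = P n.+1 + (recB L nu n)%:P * P n
               + (if n is k.+1 then (recC L nu n)%:P * P k else 0).
Proof. by move=> nu_gt0 mP n; exact: monic_mvop_recurrence. Qed.
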